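(* Let $n\ge2$ and let $P=(P_1,\ldots,P_n)$ be a positive regular polynomial $n$-tuple. The $P$-triangle $\triangle^n_P$ is a bounded Reinhardt domain contained in $\bigcap_{j=1}^n\varphi^{-1}(\mathbb B^n_{P_j})$. Moreover, for $j=1,\ldots,n$ let $\widetilde P_j$ be the one-variable polynomial $\widetilde P_j(w)=P_j(w\varepsilon_j)$ and let $\mathbb D^*_{\widetilde P_j}=\mathbb D_{\widetilde P_j}\setminus\{0\}$. Then: (i) $\triangle^n_P\subseteq\varphi^{-1}\big(\mathbb D_{\widetilde P_1}\times\mathbb D^*_{\widetilde P_2}\times\cdots\times\mathbb D^*_{\widetilde P_n}\big)$; (ii) $P$ is admissible if and only if $\triangle^n_P=\varphi^{-1}\big(\mathbb D_{\widetilde P_1}\times\mathbb D^*_{\widetilde P_2}\times\cdots\times\mathbb D^*_{\widetilde P_n}\big)$.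
   Context: $\mathbb C_*=\mathbb C\setminus\{0\}$; $\varepsilon_j$ is the $j$-th standard basis vector of $\mathbb C^n$; $z\diamond w=(z_1w_1,\ldots,z_nw_n)$; $\overline z$ is the entrywise conjugate. For $n\ge2$, $\varphi(z)=\big(\frac{z_1}{z_2},\ldots,\frac{z_{n-1}}{z_n},z_n\big)$ is an automorphism of $\mathbb C\times\mathbb C_*^{n-1}$, with inverse $\varphi^{-1}(z)=\big(\prod_{j=1}^nz_j,\ldots,\prod_{j=n-1}^nz_j,z_n\big)$, which is regarded as a polynomial mapping on all of $\mathbb C^n$; $\varphi^{-1}(A)$ denotes the image of $A\subseteq\mathbb C^n$ under this map. For a polynomial $Q\in\mathbb C[z_1,\ldots,z_k]$, the $Q$-ball is $\mathbb B^k_Q=\{z\in\mathbb C^k:|Q(z\diamond\overline z)|<1\}$, and $\mathbb D_Q=\mathbb B^1_Q$ when $k=1$. A polynomial $n$-tuple $P=(P_1,\ldots,P_n)$ in $\mathbb C[z_1,\ldots,z_n]$ is positive regular if for each $j$, $P_j$ has nonnegative coefficients and $P_j(z)=a_jz_j+\sum_{k=2}^{N_j}Q_{jk}(z)$ with $a_j>0$ and $Q_{jk}$ homogeneous of degree $k$. A positive regular $P$ is admissible if, with $d=\max_j\deg P_j$, one has for every $j$ that $(\partial^\alpha P_j)(0)=0$ for all multi-indices $\alpha\in\mathbb Z^n_+$ with $|\alpha|\le d$ and $\alpha\notin\{\ell\varepsilon_j:\ell=1,\ldots,d\}$ (that is, each $P_j$ is a polynomial in $z_j$ alone). The $P$-triangle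 is $\triangle^n_P=\{z\in\mathbb C\times\mathbb C_*^{n-1}:P_j(\varphi(z)\diamond\overline{\varphi(z)})<1,\ j=1,\ldots,n\}$. A domain is a nonempty open connected set; it is Reinhardt if it is invariant under $(z_1,\ldots,z_n)\mapsto(\zeta_1z_1,\ldots,\zeta_nz_n)$ for all $|\zeta_1|=\cdots=|\zeta_n|=1$. *)

(* Defs.v *)
From HB Require Import structures.
From mathcomp Require Import all_boot all_order all_algebra.
From mathcomp Require Import all_classical all_reals all_analysis.
From mathcomp Require Import complex.
(* The notations of mpoly are incompatible with those of mathcomp-analysis. *)
From mathcomp Require Import -(notations) mpoly.
Set Implicit Arguments.
Unset Strict Implicit.
Unset Printing Implicit Defensive.
Import Order.TTheory GRing.Theory Num.Theory.
Import numFieldNormedType.Exports.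
Local Open Scope classical_set_scope.
Local Open Scope ring_scope.

(* C^n is 'rV[C]_n, and the j-th coordinate (j = 1, ..., n) has index j - 1.
   The definitions make sense over any C : numClosedFieldType; the complex
   numbers are R[i] for R : realType.  In the order of C, x < y and x <= y
   entail that y - x is real. *)

Definition diamond (C : numClosedFieldType) (n : nat) (z w : 'rV[C]_n) :
    'rV[C]_n :=
  \row_j (z 0 j * w 0 j).

Definition conjv (C : numClosedFieldType) (n : nat) (z : 'rV[C]_n) : 'rV[C]_n :=
  \row_j (z 0 j)^*.

(* C x C_*^(n-1) *)
Definition punctured (C : numClosedFieldType) (n : nat) : set 'rV[C]_n :=
  [set z | forall j : 'I_n, (0 < j)%N -> z 0 j != 0].

(* insub j.+1 is None exactly when j is the last index. *)
Definition phi (C : numClosedFieldType) (n : nat) (z : 'rV[C]_n) : 'rV[C]_n :=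
  \row_j (if (insub j.+1 : option 'I_n) is Some k then z 0 j / z 0 k
          else z 0 j).

Definition phi_inv (C : numClosedFieldType) (n : nat) (z : 'rV[C]_n) :
    'rV[C]_n :=
  \row_(j < n) \prod_(k < n | (j <= k)%N) z 0 k.

Definition peval (C : numClosedFieldType) (n : nat) (Q : mpoly n C)
    (z : 'rV[C]_n) : C :=
  meval (fun j => z 0 j) Q.

Definition Qball (C : numClosedFieldType) (k : nat) (Q : mpoly k C) :
    set 'rV[C]_k :=
  [set z | `|peval Q (diamond z (conjv z))| < 1].

(* Qball for k = 1, under the identification of C^1 with C *)
Definition Qdisc (C : numClosedFieldType) (Q : mpoly 1 C) : set C :=
  [set w | Qball Q (const_mx w)].

(* P_j has no constant term, and its linear part is a_j z_j with a_j > 0. *)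
Definition positive_regular (C : numClosedFieldType) (n : nat)
    (P : 'I_n -> mpoly n C) : Prop :=
  forall j : 'I_n,
    (forall m : multinom n, 0 <= mcoeff m (P j)) /\
    (exists (a : C) (N : nat) (Q : nat -> mpoly n C),
      [/\ 0 < a,
          forall k, (2 <= k <= N)%N -> Q k \is ishomog1 k mdeg &
          P j = a *: mpolyX C (mnm1 j) + \sum_(2 <= k < N.+1) Q k]).

Definition admissible (C : numClosedFieldType) (n : nat)
    (P : 'I_n -> mpoly n C) : Prop :=
  let d := (\max_(j < n) (mmeasure mdeg (P j)).-1)%N in
  positive_regular P /\
  forall (j : 'I_n) (alpha : multinom n),
    (mdeg alpha <= d)%N ->
    ~ (exists2 l : nat, (1 <= l <= d)%N & alpha = mnm_muln (mnm1 j) l) ->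
    peval (mderivm alpha (P j)) 0 = 0.

Definition ptriangle (C : numClosedFieldType) (n : nat)
    (P : 'I_n -> mpoly n C) : set 'rV[C]_n :=
  [set z | punctured z /\
           forall j : 'I_n, peval (P j) (diamond (phi z) (conjv (phi z))) < 1].

(* The one-variable polynomial w |-> Q (w *: e_j), obtained by substituting
   the variable of C[z_1] for z_j and 0 for the other variables *)
Definition ptilde (C : numClosedFieldType) (n : nat) (Q : mpoly n C)
    (j : 'I_n) : mpoly 1 C :=
  comp_mpoly [tuple if i == j then mpolyX C (mnm1 ord0) else 0 | i < n] Q.

(* D_1 x D*_2 x ... x D*_n *)
Definition discprod (C : numClosedFieldType) (n : nat)
    (P : 'I_n -> mpoly n C) : set 'rV[C]_n :=
  [set w | forall j : 'I_n,
     (if (j == 0 :> nat)%N then Qdisc (ptilde (P j) j)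
      else Qdisc (ptilde (P j) j) `\ 0) (w 0 j)].

Definition is_domain (C : numClosedFieldType) (n : nat) (A : set 'rV[C]_n) : Prop :=
  [/\ A !=set0, open A & connected A].

Definition reinhardt (C : numClosedFieldType) (n : nat) (A : set 'rV[C]_n) :
    Prop :=
  forall zeta : 'rV[C]_n, (forall j, `|zeta 0 j| = 1) ->
  forall z, A z -> A (diamond zeta z).

(* Main.v *)
Require Import Defs.
From mathcomp Require Import all_boot all_order all_algebra.
From mathcomp Require Import all_classical all_reals all_analysis.
From mathcomp Require Import complex.
From mathcomp Require Import -(notations) mpoly.
Import Order.TTheory GRing.Theory Num.Theory.
Import numFieldNormedType.Exports.
Local Open Scope classical_set_scope.
Local Open Scope ring_scope.

(** Writing [w = phi z], the triangle is the image under [phi_inv] of the region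
    [{w | w_j != 0 for j >= 2, P_j(|w_1|^2, ..., |w_n|^2) < 1}].  As the [P_j]
    have nonnegative coefficients, this region is stable under decreasing the
    moduli [|w_j|], and [a_j |w_j|^2 <= P_j < 1] bounds it.  It is connected
    because each of its points is joined, with moduli never exceeding the initial
    ones, to [(0, r, ..., r)] for all small [r > 0].  Restricting [P_j] to its axis
    decreases it, whence (i).  If [P_j] has a monomial [m] involving some [z_k]
    with [k != j], fix small positive values of the other variables and move
    [|w_j|^2] along its axis until the value of the one-variable polynomial is
    within the value of that monomial of 1: this yields a point of the product of
    discs outside the region. *)

(** * Monotonicity of polynomials with nonnegative coefficients *)

Section NonnegativePolynomials.
Set Implicit Arguments.
Unset Strict Implicit.
Variables (C : numClosedFieldType) (n : nat).
Implicit Types (Q : mpoly n C) (x y : 'rV[C]_n).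

Definition mpoly_ge0 Q : Prop := forall m, 0 <= mcoeff m Q.

Lemma pevalE Q x :
  peval Q x = \sum_(m <- msupp Q) mcoeff m Q * \prod_i x 0 i ^+ m i.
Proof. exact: mevalE. Qed.

Lemma peval_ge0 Q x : mpoly_ge0 Q -> (forall i, 0 <= x 0 i) -> 0 <= peval Q x.
Proof.
move=> Qge0 xge0; rewrite pevalE; apply: sumr_ge0 => m _.
by apply: mulr_ge0 => //; apply: prodr_ge0 => i _; apply: exprn_ge0.
Qed.

Lemma le_peval Q x y : mpoly_ge0 Q ->
  (forall i, 0 <= x 0 i <= y 0 i) -> peval Q x <= peval Q y.
Proof.
move=> Qge0 xy; rewrite !pevalE; apply: ler_sum => m _.
apply: ler_wpM2l => //; apply: ler_prod => i _.
by have /andP[x0 xley] := xy i; rewrite exprn_ge0 //= lerXn2r // nnegrE (le_trans x0).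
Qed.

(** Without a constant term every monomial has degree [k >= 1], and then [s ^+ k <= s]. *)
Lemma peval_le_scale Q x (s : C) : mpoly_ge0 Q -> mcoeff mnm0 Q = 0 ->
  (forall i, 0 <= x 0 i) -> 0 <= s <= 1 ->
  peval Q (s *: x) <= s * peval Q x.
Proof.
move=> Qge0 Q0 xge0 /andP[s0 s1]; rewrite !pevalE mulr_sumr.
rewrite big_seq [leRHS]big_seq; apply: ler_sum => m mQ.
rewrite mulrCA; apply: ler_wpM2l => //.
under eq_bigr => i _ do rewrite mxE exprMn.
rewrite big_split /= ler_wpM2r //; first by apply: prodr_ge0 => i _; exact: exprn_ge0.
rewrite prodrXr -mdegE; case E: (mdeg m) => [|k]; last first.
  by rewrite exprS ler_piMr // exprn_ile1.
have m0 : m = mnm0 by apply/eqP; rewrite -mdeg_eq0 E.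
by move: mQ; rewrite mcoeff_msupp m0 Q0 eqxx.
Qed.

Lemma le_monomial_peval Q m x : mpoly_ge0 Q -> (forall i, 0 <= x 0 i) ->
  mcoeff m Q * \prod_i x 0 i ^+ m i <= peval Q x.
Proof.
move=> Qge0 xge0.
have term_ge0 m' : 0 <= mcoeff m' Q * \prod_i x 0 i ^+ m' i.
  by apply: mulr_ge0 => //; apply: prodr_ge0 => i _; apply: exprn_ge0.
have [mQ|/memN_msupp_eq0 ->] := boolP (m \in msupp Q); last first.
  by rewrite mul0r peval_ge0.
rewrite pevalE (bigD1_seq m) ?msupp_uniq //= lerDl.
exact: sumr_ge0.
Qed.

Definition axis (j : 'I_n) (t : C) : 'rV[C]_n := \row_i (if i == j then t else 0).

Lemma le_axis j x : (forall i, 0 <= x 0 i) ->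
  forall i, 0 <= axis j (x 0 j) 0 i <= x 0 i.
Proof. by move=> xge0 i; rewrite mxE; case: eqP => [->|_]; rewrite ?lexx ?xge0. Qed.

(** The monomial [m] contains the variable of index [k], so it vanishes on the axis of index [j]:
    its value is gained in full on leaving the axis, while no other term decreases. *)
Lemma le_axis_monomial_peval Q (j k : 'I_n) (m : multinom n) x : mpoly_ge0 Q ->
  (forall i, 0 <= x 0 i) -> k != j -> m k != 0 ->
  peval Q (axis j (x 0 j)) + mcoeff m Q * \prod_i x 0 i ^+ m i <= peval Q x.
Proof.
move=> Qge0 xge0 kj mk.
have [mQ|/memN_msupp_eq0 ->] := boolP (m \in msupp Q); last first.
  by rewrite mul0r addr0 le_peval // => i; exact: le_axis.
rewrite !pevalE !(bigD1_seq m) ?msupp_uniq //=.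
rewrite [X in _ * X](bigD1 k) //= mxE (negPf kj) expr0n (negPf mk) mul0r mulr0 add0r.
rewrite [leLHS]addrC. rewrite lerD2l; apply: ler_sum => m' _; apply: ler_wpM2l => //.
apply: ler_prod => i _; have /andP[a0 ax] := le_axis j xge0 i.
by rewrite exprn_ge0 //= lerXn2r // nnegrE.
Qed.

Lemma peval_axis Q j x :
  (forall (m : multinom n) k, k != j -> m k != 0 -> mcoeff m Q = 0) ->
  peval Q x = peval Q (axis j (x 0 j)).
Proof.
move=> Qj; rewrite !pevalE; apply: eq_bigr => m _.
have [->|Qm] := eqVneq (mcoeff m Q) 0; first by rewrite !mul0r.
congr (_ * _); apply: eq_bigr => i _; rewrite mxE.
case: eqP => [->//|/eqP ij]; have [->|mi] := eqVneq (m i) 0; first by rewrite !expr0.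
by rewrite (Qj m i) ?eqxx in Qm.
Qed.

Lemma peval_ptilde Q j (t : C) :
  peval (ptilde Q j) (const_mx t) = peval Q (axis j t).
Proof.
rewrite /peval /ptilde comp_mpoly_meval; apply: meval_eq => i.
by rewrite tnth_mktuple mxE; case: eqP => _; rewrite ?mevalXU ?meval0 ?mxE.
Qed.

Lemma peval0 Q : peval Q 0 = mcoeff mnm0 Q.
Proof.
have [mQ|mQ] := boolP (mnm0 \in msupp Q).
  rewrite pevalE (bigD1_seq mnm0) ?msupp_uniq //= [X in _ + X]big1 ?addr0.
    by rewrite big1 ?mulr1 // => i _; rewrite mnm0E expr0.
  move=> m m0; have /existsP[i mi] : [exists i, m i != 0%N].
    rewrite -negb_forall; apply: contra m0 => /forallP m0.
    by apply/eqP/mnmP => i; rewrite mnm0E; apply/eqP.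
  by rewrite (bigD1 i) //= mxE expr0n (negPf mi) mul0r mulr0.
rewrite (memN_msupp_eq0 mQ) pevalE big_seq big1 // => m mm.
have /existsP[i mi] : [exists i, m i != 0%N].
  rewrite -negb_forall; apply: contra mQ => /forallP m0.
  by rewrite (_ : mnm0 = m) //; apply/mnmP => i; rewrite mnm0E; apply/esym/eqP.
by rewrite (bigD1 i) //= mxE expr0n (negPf mi) mul0r mulr0.
Qed.

(** The derivative at 0 is the coefficient times the product of the factorials of the [m i], nonzero
    in characteristic 0. *)
Lemma peval_mderivm0_eq0 Q (m : multinom n) :
  (peval (mderivm m Q) 0 == 0) = (mcoeff m Q == 0).
Proof.
rewrite peval0 mcoeff_mderivm addm0 mulrn_eq0.
suff /negPf -> : (\prod_(i < n) m i ^_ m i)%N != 0%N by [].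
by rewrite -lt0n prodn_gt0 // => i; rewrite ffactnn fact_gt0.
Qed.

(** Homogeneous parts of degree at least 2 do not touch coefficients of degree below 2, so the
    constant and linear ones are read off the decomposition. *)
Lemma positive_regularP (P : 'I_n -> mpoly n C) : positive_regular P ->
  [/\ forall j, mpoly_ge0 (P j), forall j, mcoeff mnm0 (P j) = 0 &
      forall j, 0 < mcoeff (mnm1 j) (P j)].
Proof.
move=> Preg.
have low j : exists2 a : C, 0 < a & forall m : multinom n, (mdeg m < 2)%N ->
    mcoeff m (P j) = a * (mnm1 j == m)%:R.
  have [_ [a [N [Q [a0 Qhom PE]]]]] := Preg j; exists a => // m m2.
  rewrite PE mcoeffD mcoeffZ mcoeffX raddf_sum /= big_nat big1 ?addr0 // => k k2.
  apply: (dhomog_nemf_coeff (Qhom k k2)).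
  by rewrite neq_ltn (leq_trans m2) //; case/andP: k2.
split=> j; first by have [] := Preg j.
  have [a _ ->] := low j; last by rewrite mdeg0.
  by rewrite -mdeg_eq0 mdeg1 mulr0.
by have [a a0 ->] := low j; rewrite ?mdeg1 // eqxx mulr1.
Qed.
End NonnegativePolynomials.

(** * The monomial change of coordinates [phi] *)

Section Monomial.
Set Implicit Arguments.
Unset Strict Implicit.
Variables (C : numClosedFieldType) (n : nat).
Implicit Types (w z : 'rV[C]_n) (P : 'I_n -> mpoly n C).

Definition sqmod w : 'rV[C]_n := diamond w (conjv w).

Lemma sqmodE w i : sqmod w 0 i = `|w 0 i| ^+ 2.
Proof. by rewrite !mxE normCK. Qed.

Lemma sqmod_ge0 w i : 0 <= sqmod w 0 i.
Proof. by rewrite sqmodE exprn_ge0. Qed.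

Lemma phi_succ z (j k : 'I_n) : k = j.+1 :> nat -> phi z 0 j = z 0 j / z 0 k.
Proof. by move=> kE; rewrite mxE -kE valK. Qed.

Lemma phi_last z (j : 'I_n) : j.+1 = n -> phi z 0 j = z 0 j.
Proof. by move=> jn; rewrite mxE insubF // jn ltnn. Qed.

Lemma phi_inv_succ w (j k : 'I_n) : k = j.+1 :> nat ->
  phi_inv w 0 j = w 0 j * phi_inv w 0 k.
Proof.
move=> kE; rewrite !mxE (bigD1 j) //=; congr (_ * _).
by apply: eq_bigl => i; rewrite kE andbC eq_sym -ltn_neqAle.
Qed.

Lemma phi_inv_last w (j : 'I_n) : j.+1 = n -> phi_inv w 0 j = w 0 j.
Proof.
move=> jn; rewrite !mxE (big_pred1 j) // => i; apply/idP/eqP => [ji|->//].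
by apply/val_inj/eqP; rewrite eqn_leq ji andbT -ltnS jn ltn_ord.
Qed.

Variant ord_succ_spec (j : 'I_n) : Prop :=
  | OrdSucc (k : 'I_n) of k = j.+1 :> nat & (j < k)%N
  | OrdLast of j.+1 = n.

Lemma ord_succP (j : 'I_n) : ord_succ_spec j.
Proof.
have := ltn_ord j; rewrite leq_eqVlt => /orP[/eqP|jn]; first exact: OrdLast.
exact: (@OrdSucc _ (Ordinal jn)).
Qed.

Lemma punctured_phi z : punctured z -> punctured (phi z).
Proof.
move=> z0 j j0; have zj := z0 j j0; have [k kE _|jn] := ord_succP j.
  by rewrite (phi_succ _ kE) mulf_neq0 // invr_eq0 z0 // kE.
by rewrite phi_last.
Qed.

Lemma punctured_phi_inv w : punctured w -> punctured (phi_inv w).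
Proof.
move=> w0 j j0; rewrite mxE; apply/prodf_neq0 => k jk.
exact/w0/(leq_trans j0).
Qed.

Lemma phi_invK w : punctured w -> phi (phi_inv w) = w.
Proof.
move=> w0; apply/rowP => j; have [k kE _|jn] := ord_succP j.
  by rewrite (phi_succ _ kE) (phi_inv_succ _ kE) mulfK // punctured_phi_inv // kE.
by rewrite phi_last ?phi_inv_last.
Qed.

Lemma phiK z : punctured z -> phi_inv (phi z) = z.
Proof.
move=> z0; apply/rowP => j.
(* Induction from the last index downwards: coordinate [j] of [phi_inv] is computed from coordinate
   [j + 1]. *)
have [m] := ubnP (n - j); elim: m j => // m IHm j; rewrite ltnS => jm.
have [k kE jk|jn] := ord_succP j; last by rewrite phi_inv_last ?phi_last.
rewrite (phi_inv_succ _ kE) (phi_succ _ kE) IHm ?divfK ?z0 ?kE //.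
by apply: leq_trans jm; rewrite ltn_sub2l.
Qed.

Definition modulus_region P : set 'rV[C]_n :=
  [set w | punctured w /\ forall j, peval (P j) (sqmod w) < 1].

(** The two monomial maps are mutually inverse on punctured points, which moves every question to a
    region described by the moduli of [w = phi z]. *)
Lemma ptriangleE P : ptriangle P = @phi_inv C n @` modulus_region P.
Proof.
apply/seteqP; split=> [z [z0 Pz]|_ [w [w0 Pw] <-]].
  by exists (phi z); rewrite ?phiK //; split=> //; exact: punctured_phi.
by split; [exact: punctured_phi_inv | rewrite phi_invK].
Qed.

Lemma phi_inv_modulus_region P w : punctured w ->
  ptriangle P (phi_inv w) -> modulus_region P w.
Proof. by move=> w0 [_]; rewrite phi_invK. Qed.

Lemma sqmod_const_mx (t : C) :
  diamond (const_mx t : 'rV_1) (conjv (const_mx t)) = const_mx (`|t| ^+ 2).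
Proof. by apply/rowP => i; rewrite !mxE normCK. Qed.

Lemma discprodP P w :
  discprod P w <->
  punctured w /\ forall j, `|peval (P j) (axis j (sqmod w 0 j))| < 1.
Proof.
rewrite /discprod /Qdisc /Qball /=.
split=> [Dw|[w0 Pw] j].
  split=> [j j0|j]; have := Dw j.
    by rewrite (gtn_eqF j0) => -[_ /eqP].
  by case: ifP => _ => [|[]]; rewrite /= sqmod_const_mx peval_ptilde sqmodE.
have := Pw j; rewrite sqmodE -peval_ptilde -sqmod_const_mx.
by case: ifP => // /negbT; rewrite -lt0n => /w0/eqP wj0 Pj; split.
Qed.

End Monomial.

(** * Continuity, openness and boundedness *)

Section Continuity.
Set Implicit Arguments.
Unset Strict Implicit.
Variables (C : numClosedFieldType) (n : nat).
Implicit Types (w z : 'rV[C]_n) (P : 'I_n -> mpoly n C).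

Lemma cvg_row (T : Type) (F : set_system T) (FF : Filter F) (f : T -> 'rV[C]_n)
    (l : 'rV[C]_n) :
  (forall j, f x 0 j @[x --> F] --> l 0 j) -> f x @[x --> F] --> l.
Proof.
move=> fl A [B Bl sBA].
have nearB : \forall x \near F, forall j, B 0 j (f x 0 j).
  by apply: filter_forall => j; exact: fl (Bl 0 j).
by apply: filterS nearB => x Bx; apply: sBA => i j; rewrite ord1.
Qed.

Lemma cvg_exprn (T : Type) (F : set_system T) (FF : Filter F) (f : T -> C) (l : C)
    (k : nat) :
  f x @[x --> F] --> l -> f x ^+ k @[x --> F] --> l ^+ k.
Proof.
move=> fl; elim: k => [|k IHk]; first exact: cvg_cst.
under eq_fun do rewrite exprS.
by rewrite exprS; exact: cvgM.
Qed.

Lemma cvg_peval (T : Type) (F : set_system T) (FF : Filter F) (Q : mpoly n C)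
    (f : T -> 'rV[C]_n) (l : 'rV[C]_n) :
  (forall j, f x 0 j @[x --> F] --> l 0 j) ->
  peval Q (f x) @[x --> F] --> peval Q l.
Proof.
move=> fl; under eq_fun do rewrite pevalE.
rewrite pevalE; apply: cvg_big => [|m _]; first exact: add_continuous.
apply: cvgM; first exact: cvg_cst.
by apply: cvg_big => [|i _]; [exact: mul_continuous | exact: cvg_exprn].
Qed.

Lemma cvg_phi_inv (T : Type) (F : set_system T) (FF : Filter F)
    (f : T -> 'rV[C]_n) w :
  (forall j, f x 0 j @[x --> F] --> w 0 j) -> phi_inv (f x) @[x --> F] --> phi_inv w.
Proof.
move=> fw; apply: cvg_row => j; under eq_fun do rewrite mxE.
by rewrite mxE; apply: cvg_big => // ; exact: mul_continuous.
Qed.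

Lemma cvg_phi (T : Type) (F : set_system T) (FF : Filter F) (f : T -> 'rV[C]_n)
    z j : punctured z ->
  (forall j, f x 0 j @[x --> F] --> z 0 j) ->
  phi (f x) 0 j @[x --> F] --> phi z 0 j.
Proof.
move=> z0 fz; have [k kE _|jn] := ord_succP j.
  under eq_fun do rewrite (phi_succ _ kE).
  rewrite (phi_succ _ kE); apply: cvgM => //.
  by apply: cvgV => //; rewrite z0 // kE.
under eq_fun do rewrite phi_last //.
rewrite phi_last //; exact: fz.
Qed.

Lemma cvg_peval_phi (T : Type) (F : set_system T) (FF : Filter F)
    (Q : mpoly n C) (f : T -> 'rV[C]_n) z : punctured z ->
  (forall j, f x 0 j @[x --> F] --> z 0 j) ->
  peval Q (sqmod (phi (f x))) @[x --> F] --> peval Q (sqmod (phi z)).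
Proof.
move=> z0 fz; apply: cvg_peval => i; under eq_fun do rewrite sqmodE.
by rewrite sqmodE; apply: cvg_exprn; apply: cvg_norm; exact: cvg_phi.
Qed.

Lemma open_ptriangle P : (forall j, mpoly_ge0 (P j)) -> open (ptriangle P).
Proof.
move=> Pge0; rewrite openE => z [z0 Pz].
have near_neq0 (j : 'I_n) : nbhs z [set x : 'rV[C]_n | (0 < j)%N -> x 0 j != 0].
  have [j0|_] := boolP (0 < j)%N; last by apply: filterE => x.
  apply: filterS (cvgr_neq0 _ (@coord_continuous C 1 n 0 j z) (z0 j j0)).
  by move=> x xj.
(* The values are nonnegative at every point, so taking norms loses nothing and turns the inequality
   into an open condition. *)
have near_lt1 j : nbhs z [set x | `|peval (P j) (sqmod (phi x))| < 1].
  have zj := @cvg_peval_phi _ (nbhs z) (nbhs_filter z) (P j) id z z0 (fun k => @coord_continuous C 1 n 0 k z).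
  have Pz1 : `|peval (P j) (sqmod (phi z))| < 1.
    by rewrite ger0_norm ?Pz // peval_ge0 // => i; exact: sqmod_ge0.
  exact: (cvgr_norm_lt _ zj _ Pz1).
have near0 := @filter_forall _ _ _ (nbhs z) (nbhs_filter z) near_neq0.
have near1 := @filter_forall _ _ _ (nbhs z) (nbhs_filter z) near_lt1.
apply: (@filterS _ (nbhs z) _ _ _ _ (filterI near0 near1)).
move=> x [x0 Px]; split=> // j; apply: le_lt_trans (Px j).
by apply/real_ler_norm/ger0_real/peval_ge0 => // i; exact: sqmod_ge0.
Qed.

(** The linear term gives [|w_i|^2 < 1/a]. Adding 1 to the bound avoids a square root: either
    [|w_i| <= 1], or [|w_i| <= |w_i|^2]. *)
Lemma modulus_region_bound P w : positive_regular P -> modulus_region P w ->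
  forall i, `|w 0 i| <= 1 + (mcoeff (mnm1 i) (P i))^-1.
Proof.
move=> /positive_regularP[Pge0 _ Ppos] [w0 Pw] i.
have ai := Ppos i; set a := mcoeff _ _ in ai *.
have aw : `|w 0 i| ^+ 2 < a^-1.
  rewrite -[a^-1]mul1r ltr_pdivlMr // mulrC; apply: le_lt_trans (Pw i).
  rewrite -sqmodE (le_trans _ (le_monomial_peval (mnm1 i) (Pge0 i) (sqmod_ge0 w))) //.
  rewrite (bigD1 i) //= mnm1E eqxx expr1 big1 ?mulr1 // => k ki.
  by rewrite mnm1E eq_sym (negPf ki) expr0.
have [w1|w1] := real_leP (normr_real (w 0 i)) (@real1 C).
  by rewrite (le_trans w1) // lerDl invr_ge0 ltW.
rewrite (le_trans _ (ltW (lt_le_trans aw _))) //.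
  by rewrite expr2 ler_peMl // ltW.
by rewrite lerDr.
Qed.

Lemma bounded_ptriangle P : positive_regular P -> bounded_set (ptriangle P).
Proof.
(* Every factor of [M] is at least 1, so [M] also bounds the partial products that are the
   coordinates of [phi_inv w]. *)
move=> Preg; pose M := \prod_i (1 + (mcoeff (mnm1 i) (P i))^-1).
have [_ _ Ppos] := positive_regularP Preg.
have b1 i : 1 <= 1 + (mcoeff (mnm1 i) (P i))^-1 by rewrite lerDl invr_ge0 ltW.
have M1 : 1 <= M.
  have -> : 1 = \prod_(i < n) (1 : C) by rewrite big1.
  by apply: ler_prod => i _; rewrite ler01 b1.
exists M; split; first by rewrite ger1_real.
move=> x Mx z; rewrite ptriangleE => -[w Rw <-] /=.
apply: le_trans (ltW Mx).
rewrite -[`|_|]/(mx_norm (phi_inv w)).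
have [->|/eqP/mx_norm_neq0[[i j] ->]] := pselect (mx_norm (phi_inv w) = 0).
  by rewrite (le_trans _ M1).
rewrite /= mxE normr_prod big_mkcond /=; apply: ler_prod => k _.
case: ifP => _; last by rewrite ler01 b1.
by rewrite normr_ge0 modulus_region_bound.
Qed.

End Continuity.

(** * Rotation invariance, the inclusions, and admissibility in terms of coefficients *)

Section Geometry.
Set Implicit Arguments.
Unset Strict Implicit.
Variables (C : numClosedFieldType) (n : nat) (P : 'I_n -> mpoly n C).
Hypothesis P_posreg : positive_regular P.
Implicit Types (q u v w z : 'rV[C]_n).

Let Pge0 j : mpoly_ge0 (P j).
Proof. by have [] := positive_regularP P_posreg. Qed.

Lemma modulus_region_sub w u : modulus_region P w -> punctured u ->
  (forall i, `|u 0 i| <= `|w 0 i|) -> modulus_region P u.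
Proof.
move=> [_ Pw] u0 uw; split=> // j; apply: le_lt_trans (Pw j).
apply: le_peval => // i; rewrite sqmod_ge0 !sqmodE.
by rewrite lerXn2r ?nnegrE.
Qed.

Lemma reinhardt_ptriangle : reinhardt (ptriangle P).
Proof.
move=> zeta zeta1 z [z0 Pz].
have zetaz0 : punctured (diamond zeta z).
  move=> j /z0 zj; rewrite mxE mulf_neq0 // -normr_eq0 zeta1.
  exact: oner_neq0.
(* Each coordinate of [phi] is multiplied by [zeta_j / zeta_k] or by [zeta_j], of modulus 1. *)
have sqmod_phi : sqmod (phi (diamond zeta z)) = sqmod (phi z).
  apply/rowP => j; rewrite !sqmodE; congr (_ ^+ 2).
  have [k kE _|jn] := ord_succP j.
    by rewrite !(phi_succ _ kE) !normf_div !mxE !normrM !zeta1 !mul1r.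
  by rewrite !phi_last // mxE normrM zeta1 mul1r.
by split=> // j; rewrite -/(sqmod _) sqmod_phi Pz.
Qed.

Lemma modulus_region_discprod : modulus_region P `<=` discprod P.
Proof.
move=> w [w0 Pw]; apply/discprodP; split=> // j.
rewrite ger0_norm; last first.
  by apply: peval_ge0 => // i; rewrite mxE; case: ifP => // _; exact: sqmod_ge0.
apply: le_lt_trans (Pw j); apply: le_peval => // i.
by apply: le_axis => k; exact: sqmod_ge0.
Qed.

Lemma ptriangle_sub_Qball :
  ptriangle P `<=` \bigcap_(j in [set: 'I_n]) (@phi_inv C n @` Qball (P j)).
Proof.
rewrite ptriangleE => _ [w [w0 Pw] <-] j _; exists w => //.
by rewrite /Qball /= ger0_norm ?Pw // peval_ge0 // => i; exact: sqmod_ge0.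
Qed.

Lemma ptriangle_sub_discprod : ptriangle P `<=` @phi_inv C n @` discprod P.
Proof.
by rewrite ptriangleE => _ [w Rw <-]; exists w => //; exact: modulus_region_discprod.
Qed.

(** Points of [discprod P] are punctured, and [phi_inv] is injective on such points, so equality of
    the images lifts to an inclusion of their sources. *)
Lemma ptriangle_eq_discprodP :
  ptriangle P = @phi_inv C n @` discprod P <-> discprod P `<=` modulus_region P.
Proof.
split=> [eqP w Dw|DR].
  have [w0 _] := (discprodP _ _).1 Dw.
  by apply: phi_inv_modulus_region => //; rewrite eqP; exists w.
apply/seteqP; split; first exact: ptriangle_sub_discprod.
by rewrite ptriangleE => _ [w /DR Rw <-]; exists w.
Qed.

(** The bound [d] dominates the degree of every [P j], so the conditions on derivatives at 0 reach
    all coefficients. *)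
Lemma admissible_mcoeff_eq0 : admissible P <->
  forall j k (m : multinom n), k != j -> m k != 0%N -> mcoeff m (P j) = 0.
Proof.
split=> [[_ adm] j k m kj mk|Pj].
  have [mP|/memN_msupp_eq0 //] := boolP (m \in msupp (P j)).
  apply/eqP; rewrite -peval_mderivm0_eq0; apply/eqP/adm.
    apply: leq_trans (leq_bigmax j).
    (* For a nonzero polynomial [mmeasure] is one more than the degree, whence the predecessor in
       [d]. *)
    by have := mmeasure_mnm_lt mdeg mP; case: mmeasure.
  case=> l _ mE; move: mk; rewrite mE mulmnE mnm1E [j == k]eq_sym (negPf kj).
  by rewrite mul0n eqxx.
split=> // j m md mj; apply/eqP; rewrite peval_mderivm0_eq0; apply/eqP.
(* The exponents [l] start at 1, so the index 0 is not exempt; there the constant term vanishes by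
   regularity. *)
have [m0|m0] := eqVneq m mnm0.
  by rewrite m0; have [] := positive_regularP P_posreg.
have [/existsP[k /andP[kj mk]]|] := boolP [exists k, (k != j) && (m k != 0%N)].
  exact: Pj kj mk.
rewrite negb_exists => /forallP mjs.
have mE : m = mnm_muln (mnm1 j) (m j).
  apply/mnmP => i; rewrite mulmnE mnm1E [j == i]eq_sym.
  have := mjs i; rewrite negb_and negbK; case: eqP => [->|_] /=.
    by rewrite mul1n.
  by rewrite negbK mul0n => /eqP.
case: mj; exists (m j) => //; rewrite -mdeg_eq0 mE mdegMn mdeg1 mul1n in m0 md.
by rewrite lt0n m0.
Qed.

Lemma admissible_discprod_sub : admissible P -> discprod P `<=` modulus_region P.
Proof.
move=> /admissible_mcoeff_eq0 Pj w /discprodP[w0 Pw]; split=> // j.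
rewrite (@peval_axis _ _ _ j) => [|m k]; last exact: Pj.
apply: le_lt_trans (Pw j); apply/real_ler_norm/ger0_real/peval_ge0 => // i.
by rewrite mxE; case: ifP => // _; exact: sqmod_ge0.
Qed.

(** * Small points of the region, and paths that do not increase moduli *)

Lemma peval_const_mx_lt1 : exists2 t : C, 0 < t &
  forall j, peval (P j) (const_mx t) < 1.
Proof.
(* Each value at the all-ones vector is at most [S], and scaling that vector by [1 / (1 + S)]
   multiplies the value by at most this factor. *)
pose S := \sum_j peval (P j) (const_mx 1).
have P1_ge0 j : 0 <= peval (P j) (const_mx 1).
  by apply: peval_ge0 => // i; rewrite mxE.
have S_ge0 : 0 <= S by apply: sumr_ge0.
have S1_gt0 : 0 < 1 + S by rewrite ltr_wpDr.
exists (1 + S)^-1 => [|j]; first by rewrite invr_gt0.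
have -> : const_mx (1 + S)^-1 = (1 + S)^-1 *: const_mx 1 :> 'rV[C]_n.
  by apply/rowP => i; rewrite !mxE mulr1.
apply: (@le_lt_trans _ _ ((1 + S)^-1 * peval (P j) (const_mx 1))).
  apply: peval_le_scale => //.
  - by have [] := positive_regularP P_posreg.
  - by move=> i; rewrite mxE.
  - by rewrite invr_ge0 ltW //= invf_le1 // lerDl.
rewrite mulrC ltr_pdivrMr // mul1r ltr_pwDl // /S (bigD1 j) //= lerDl.
exact: sumr_ge0.
Qed.

Lemma modulus_region_neq0 : modulus_region P !=set0.
Proof.
have [t t0 Pt] := peval_const_mx_lt1.
exists (const_mx (sqrtC t)); split=> [j _|j]; first by rewrite mxE sqrtC_eq0 gt_eqF.
suff -> : sqmod (const_mx (sqrtC t) : 'rV_n) = const_mx t by [].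
by apply/rowP => i; rewrite sqmodE !mxE ger0_norm ?sqrtC_ge0 ?ltW // sqrtCK.
Qed.

(* The square of a segment.  If [v 0 j] lies in the closed right half-plane and
   [q 0 j > 0], the segment avoids 0 even when [v 0 j ^+ 2] is a negative real. *)
Definition sqpath v q (c : C) : 'rV[C]_n :=
  \row_j ((1 - c) * v 0 j + c * q 0 j) ^+ 2.

Lemma cvg_sqpath (T : Type) (F : set_system T) (FF : Filter F) (f : T -> C) v q (c : C) :
  f x @[x --> F] --> c -> sqpath v q (f x) @[x --> F] --> sqpath v q c.
Proof.
move=> fc; apply: cvg_row => j; under eq_fun do rewrite mxE.
rewrite mxE; apply: cvg_exprn; apply: cvgD; apply: cvgM => //; try exact: cvg_cst.
by apply: cvgB => //; exact: cvg_cst.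
Qed.

Lemma sqpath_continuous v q : continuous (sqpath v q).
Proof. by move=> c; apply: (@cvg_sqpath _ (nbhs c) (nbhs_filter c) id). Qed.

(** The segment from [v_j] to [q_j] stays in the disc of radius [|v_j|] by convexity; when [v_j] is
    a square root of [w_j], the bound is [|w_j|]. *)
Lemma le_norm_sqpath v q c j : 0 <= c <= 1 -> 0 <= q 0 j <= `|v 0 j| ->
  `|sqpath v q c 0 j| <= `|v 0 j| ^+ 2.
Proof.
move=> /andP[c0 c1] /andP[q0 qv]; rewrite mxE normrX lerXn2r ?nnegrE //.
rewrite (le_trans (ler_normD _ _)) // !normrM ger0_norm ?subr_ge0 // (ger0_norm c0).
rewrite (ger0_norm q0) (le_trans (lerD (lexx _) (ler_wpM2l c0 qv))) //.
by rewrite -mulrDl subrK mul1r.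
Qed.

(** The real part on the segment is a sum of two nonnegative terms; its vanishing forces [c = 0],
    where the segment is at [v_j]. *)
Lemma sqpath_neq0 v q c j : 0 <= c <= 1 -> 0 < q 0 j -> 0 <= 'Re (v 0 j) ->
  v 0 j != 0 -> sqpath v q c 0 j != 0.
Proof.
move=> /andP[c0 c1] q0 v0 vn0; rewrite mxE expf_neq0 //.
apply/eqP => eq0; have : 'Re ((1 - c) * v 0 j + c * q 0 j) = 0.
  by rewrite eq0 (Creal_ReP 0 _) // rpred0.
have c'0 : 0 <= 1 - c by rewrite subr_ge0.
rewrite raddfD /= ReMl ?ger0_real // (Creal_ReP (c * q 0 j) _) ?ger0_real ?mulr_ge0 ?(ltW q0) //.
move=> /eqP; rewrite paddr_eq0 ?mulr_ge0 // ?(ltW q0) // => /andP[_].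
rewrite mulf_eq0 (gt_eqF q0) orbF => /eqP cE; move: eq0.
by rewrite cE subr0 mul1r mul0r addr0; apply/eqP.
Qed.

Lemma sqrt_Re_ge0 (x : C) : exists2 y, y ^+ 2 = x & 0 <= 'Re y.
Proof.
have [Re0|Re0] := real_leP (@real0 C) (Creal_Re (sqrtC x)).
  by exists (sqrtC x); rewrite ?sqrtCK.
by exists (- sqrtC x); rewrite ?sqrrN ?sqrtCK // raddfN oppr_ge0 ltW.
Qed.

(** The reciprocal of 1 plus the sum of reciprocals replaces a minimum, the order of [C] being
    partial. *)
Lemma pos_lower_bound (I : finType) (f : I -> C) : (forall i, 0 < f i) ->
  exists2 e, 0 < e & forall i, e <= f i.
Proof.
move=> f0; pose S := \sum_i (f i)^-1.
have S0 : 0 <= S by apply: sumr_ge0 => i _; rewrite invr_ge0 ltW.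
have S1 : 0 < 1 + S by rewrite ltr_wpDr.
exists (1 + S)^-1 => [|i]; first by rewrite invr_gt0.
rewrite -[f i]invrK lef_pV2 ?posrE ?invr_gt0 // /S (bigD1 i) //= addrCA lerDl.
by rewrite addr_ge0 ?ler01 // sumr_ge0 // => k _; rewrite invr_ge0 ltW.
Qed.

End Geometry.

(** * Connectedness over the complex numbers *)

Section ComplexNumbers.
Set Implicit Arguments.
Unset Strict Implicit.
Variables (R : realType) (n : nat).
Local Notation C := (Num.ClosedField.sort (R[i] : numClosedFieldType)).

Lemma real_complex_continuous : continuous (fun s : R => (s%:C)%C : C).
Proof.
move=> s; apply/cvgrPdist_lt => e e0.
have eE : e = ((complex.Re e)%:C)%C by rewrite RRe_real ?gtr0_real.
have Re0 : 0 < complex.Re e by rewrite -ltcR -eE.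
apply/nbhs_ballP; exists (complex.Re e) => //= t st.
rewrite eE -rmorphB /= normc_def /= expr0n addr0 sqrtr_sqr ltcR.
exact: st.
Qed.

Lemma connected_path (f : C -> 'rV[C]_n) : continuous f ->
  exists A, [/\ connected A, A (f 0), A (f 1) &
    A `<=` [set f c | c in [set c | 0 <= c <= 1]]].
Proof.
move=> fc; exists ((fun s : R => f (s%:C)%C) @` `[0, 1]); split.
- apply: connected_continuous_connected; first exact: segment_connected.
  apply: continuous_subspaceT => s.
  exact: (@continuous_comp R C 'rV[C]_n (fun s : R => (s%:C)%C : C) f s
    (@real_complex_continuous s) (fc _)).
- by exists 0; rewrite //= in_itv /= lexx ler01.
- by exists 1; rewrite //= in_itv /= lexx ler01.
- move=> _ [s /= s01 <-]; exists (s%:C)%C => //; rewrite in_itv /= in s01.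
  by rewrite /= -(lecR 0) -(lecR s) in s01.
Qed.

Variable P : 'I_n -> mpoly n C.
Hypothesis P_posreg : positive_regular P.

Let Pge0 j : mpoly_ge0 (P j).
Proof. by have [] := positive_regularP P_posreg. Qed.

(** The first coordinate is allowed to vanish; taking it to be 0 makes this point reachable without
    increasing moduli, even from [w_1 = 0]. *)
Definition basepoint (e : C) : 'rV[C]_n :=
  \row_(j < n) (if (j == 0 :> nat)%N then 0 else e).

(** Every [e] below the threshold is allowed, so that paths from two different points can be given a
    common end. *)
Lemma modulus_region_path (w : 'rV[C]_n) : modulus_region P w ->
  exists2 e0, 0 < e0 & forall e, 0 < e -> e <= e0 ->
  exists A, [/\ connected A, A w, A (basepoint (e ^+ 2)) & A `<=` modulus_region P].
Proof.
move=> Rw; have [w0 _] := Rw.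
have /choice[v vP] : forall j, exists y, y ^+ 2 = w 0 j /\ 0 <= 'Re y.
  by move=> j; have [y ? ?] := sqrt_Re_ge0 (w 0 j); exists y.
have vn0 (j : 'I_n) : (0 < j)%N -> v j != 0.
  by move=> /w0; rewrite -(vP j).1 expf_eq0.
(* Only the first coordinate can vanish, and its target is 0: it puts no constraint on [e], hence
   the default value 1. *)
have [|e0 e00 e0P] := @pos_lower_bound C 'I_n (fun j => if v j == 0 then 1 else `|v j|).
  by move=> j; case: ifPn => // vj; rewrite normr_gt0.
exists e0 => // e egt0 ee0.
have [A [Ac A0 A1 Asub]] := connected_path (@sqpath_continuous _ _ (\row_j v j) (basepoint e)).
have qle j : 0 <= basepoint e 0 j <= `|(\row_j v j) 0 j|.
  rewrite !mxE; case: ifPn => [_|]; first by rewrite lexx normr_ge0.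
  rewrite -lt0n => /vn0 vj; rewrite (ltW egt0) (le_trans ee0) //.
  by have := e0P j; rewrite (negPf vj).
exists A; split=> //.
- suff <- : sqpath (\row_j v j) (basepoint e) 0 = w by [].
  by apply/rowP => j; rewrite !mxE subr0 mul1r mul0r addr0 (vP j).1.
- suff <- : sqpath (\row_j v j) (basepoint e) 1 = basepoint (e ^+ 2) by [].
  apply/rowP => j; rewrite !mxE subrr mul0r mul1r add0r.
  by case: ifP => // _; rewrite expr0n.
- move=> _ /Asub[c c01 <-]; apply: (modulus_region_sub P_posreg Rw) => j.
    move=> j0; apply: sqpath_neq0 => //; rewrite mxE ?vn0 ?(vP j).2 //.
    by rewrite gtn_eqF.
  by rewrite (le_trans (le_norm_sqpath c01 (qle j))) // mxE -normrX (vP j).1.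
Qed.

Lemma connected_modulus_region : connected (modulus_region P).
Proof.
have [w0 Rw0] := modulus_region_neq0 P_posreg.
have -> : modulus_region P =
    \bigcup_(A in [set A | [/\ connected A, A w0 & A `<=` modulus_region P]]) A.
  apply/seteqP; split=> [w Rw|w [A [_ _ AR] /AR //]].
  have [e0 e0gt0 e0P] := modulus_region_path Rw0.
  have [e1 e1gt0 e1P] := modulus_region_path Rw.
  (* A common [e] below both thresholds makes the two paths meet at the same base point. *)
  have [|e egt0 eP] := @pos_lower_bound C bool (fun b => if b then e0 else e1).
    by case.
  have [A0 [A0c A0w0 A0e A0R]] := e0P e egt0 (eP true).
  have [A1 [A1c A1w A1e A1R]] := e1P e egt0 (eP false).
  exists (A0 `|` A1); last by right.
  split; [|by left|by rewrite subUset].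
  by apply: connectedU => //; exists (basepoint (e ^+ 2)).
apply: bigcup_connected; last by move=> A [].
by exists w0 => A [].
Qed.

Lemma is_domain_ptriangle : is_domain (ptriangle P).
Proof.
split.
- by rewrite ptriangleE; have [w Rw] := modulus_region_neq0 P_posreg; exists (phi_inv w), w.
- exact: open_ptriangle.
- rewrite ptriangleE; apply: connected_continuous_connected.
    exact: connected_modulus_region.
  apply: continuous_subspaceT => w.
  by apply: (@cvg_phi_inv _ _ _ (nbhs w)) => j; exact: coord_continuous.
Qed.

(** * Values near 1 on an axis, and the necessity of admissibility *)

Lemma peval_axis_IVT (Q : mpoly n C) j (s t y : C) : mpoly_ge0 Q ->
  0 <= s -> s <= t -> peval Q (axis j s) <= y <= peval Q (axis j t) ->
  exists2 x, s <= x & peval Q (axis j x) = y.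
Proof.
move=> Qge0 s0 st /andP[sy yt].
(* The coefficients are nonnegative, hence real: [p] is a polynomial over [R] that agrees with [Q]
   on the axis at real arguments. *)
pose p : {poly R} := \sum_(m <- msupp Q) (complex.Re (mcoeff m Q))%:P *
  \prod_i (if i == j then 'X else 0) ^+ m i.
have pE (x : R) : ((p.[x])%:C)%C = peval Q (axis j (x%:C)%C).
  rewrite pevalE /p horner_sum rmorph_sum; apply: eq_bigr => m _.
  rewrite hornerM hornerC rmorphM /= RRe_real ?ger0_real //; congr (_ * _).
  rewrite horner_prod rmorph_prod; apply: eq_bigr => i _.
  rewrite horner_exp rmorphXn mxE; congr (_ ^+ _).
  by case: ifP => _; rewrite ?hornerX ?horner0.
have realE (x : C) : 0 <= x -> exists r : R, x = (r%:C)%C.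
  by move=> /ger0_real/complex_realP.
have y0 : 0 <= y.
  apply: le_trans sy; apply: peval_ge0 => // i.
  by rewrite mxE; case: ifP.
have [r rE] := realE s s0; have [b bE] := realE t (le_trans s0 st).
have [c cE] := realE y y0; subst s t y.
rewrite -!pE !lecR in st sy yt.
have [|x /andP[rx _]] := @poly_ivt _ (p - c%:P) r b st.
  by rewrite !hornerE subr_le0 subr_ge0 sy yt.
rewrite rootE !hornerE subr_eq0 => /eqP px.
by exists (x%:C)%C; rewrite ?lecR // -pE px.
Qed.

(** The linear term makes the axis value reach 1 by [1/a], so unless the value at [s] is already at
    least [1 - d], the value [1 - d] is taken beyond [s]. *)
Lemma exists_axis_near1 j (s d : C) : 0 < s -> 0 < d -> peval (P j) (axis j s) < 1 ->
  exists2 x, s <= x & 1 - d <= peval (P j) (axis j x) < 1.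
Proof.
move=> s0 d0 Ps1; have [_ _ Ppos] := positive_regularP P_posreg.
have axis_ge0 (x : C) : 0 <= x -> forall i, 0 <= axis j x 0 i.
  by move=> x0 i; rewrite mxE; case: ifP.
have linear_le (x : C) : 0 <= x -> mcoeff (mnm1 j) (P j) * x <= peval (P j) (axis j x).
  move=> x0; apply: le_trans (le_monomial_peval (mnm1 j) (Pge0 j) (axis_ge0 x x0)).
  rewrite (bigD1 j) //= mxE eqxx mnm1E eqxx expr1 big1 ?mulr1 // => i ij.
  by rewrite mnm1E [j == i]eq_sym (negPf ij) expr0.
pose a := mcoeff (mnm1 j) (P j).
have Ps_real : peval (P j) (axis j s) \is Num.real.
  by apply/ger0_real/peval_ge0 => //; apply/axis_ge0/ltW.
have d_real : 1 - d \is Num.real by rewrite rpredB ?gtr0_real.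
have [dPs|/ltW Psd] := real_leP d_real Ps_real; first by exists s; rewrite // dPs.
have sa : s <= a^-1.
  rewrite -[a^-1]mul1r ler_pdivlMr ?Ppos // mulrC.
  exact: le_trans (linear_le s (ltW s0)) (ltW Ps1).
have Pa1 : 1 <= peval (P j) (axis j a^-1).
  apply: le_trans (linear_le _ (le_trans (ltW s0) sa)).
  by rewrite divff ?gt_eqF ?Ppos.
have [|x sx Px] := @peval_axis_IVT _ j s a^-1 (1 - d) (Pge0 j) (ltW s0) sa.
  by rewrite Psd (le_trans _ Pa1) // gerBl ltW.
by exists x => //; rewrite Px lexx gtrBl.
Qed.

Lemma discprod_sub_admissible : discprod P `<=` modulus_region P -> admissible P.
Proof.
move=> DR; apply/(admissible_mcoeff_eq0 P_posreg) => j k m kj mk.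
apply/eqP; apply: contraT => Pm.
have Pm0 : 0 < mcoeff m (P j) by rewrite lt_neqAle eq_sym Pm Pge0.
have [s s0 Ps] := peval_const_mx_lt1 P_posreg.
have axis_lt1 i : peval (P i) (axis i s) < 1.
  apply: le_lt_trans (Ps i); apply: le_peval => // l.
  by rewrite !mxE; case: ifP => _; rewrite ?lexx ltW.
(* The value of the term at [(s, ..., s)], a lower bound for it wherever all coordinates are at
   least [s]. *)
pose d := mcoeff m (P j) * \prod_(i < n) s ^+ m i.
have d0 : 0 < d by rewrite mulr_gt0 // prodr_gt0 // => i _; exact: exprn_gt0.
have [t st /andP[Pt Pt1]] := exists_axis_near1 s0 d0 (axis_lt1 j).
(* All axis values of [x] are below 1, yet [P j] at [x] is at least its axis value plus [d], hence
   at least 1. *)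
pose x : 'rV[C]_n := \row_i (if i == j then t else s).
have x0 i : 0 < x 0 i by rewrite mxE; case: ifP => // _; exact: lt_le_trans st.
pose w : 'rV[C]_n := \row_i sqrtC (x 0 i).
have sqw : sqmod w = x.
  by apply/rowP => i; rewrite sqmodE [w 0 i]mxE ger0_norm ?sqrtCK // sqrtC_ge0 ltW.
have : modulus_region P w.
  apply/DR/discprodP; split=> [i _|i]; first by rewrite mxE sqrtC_eq0 gt_eqF.
  rewrite sqw ger0_norm; last first.
    by apply: peval_ge0 => // l; rewrite mxE; case: ifP => // _; exact/ltW/x0.
  by rewrite mxE; case: eqP => [->|_].
case=> _ /(_ j); rewrite sqw => Px1.
suff P1 : 1 <= peval (P j) x by have := lt_le_trans Px1 P1; rewrite ltxx.
apply: le_trans (le_axis_monomial_peval (Pge0 j) (fun i => ltW (x0 i)) kj mk).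
rewrite [x 0 j]mxE eqxx -lerBlDr (le_trans _ Pt) // lerD2l lerN2.
apply: ler_wpM2l; first exact: ltW.
apply: ler_prod => i _.
rewrite exprn_ge0 ?(ltW s0) //= lerXn2r ?nnegrE ?(ltW s0) ?(ltW (x0 i)) //.
by rewrite mxE; case: ifP.
Qed.

End ComplexNumbers.

Theorem proposition2p3 (R : realType) (n : nat) (P : 'I_n -> mpoly n R[i])
    (n_ge2 : (2 <= n)%N) (P_posreg : positive_regular P) :
  [/\ bounded_set (ptriangle P),
      is_domain (ptriangle P),
      reinhardt (ptriangle P) &
      ptriangle P `<=` \bigcap_(j in [set: 'I_n]) (@phi_inv _ n @` Qball (P j))]
  /\
  [/\ ptriangle P `<=` @phi_inv _ n @` discprod P &
      admissible P <-> ptriangle P = @phi_inv _ n @` discprod P].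
Proof.
split; split.
- exact: bounded_ptriangle.
- exact: is_domain_ptriangle.
- exact: reinhardt_ptriangle.
- exact: ptriangle_sub_Qball.
- exact: ptriangle_sub_discprod.
- apply: iff_trans (iff_sym (ptriangle_eq_discprodP P_posreg)); split.
    exact: admissible_discprod_sub.
  exact: discprod_sub_admissible.
Qed.
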